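(* Let $\mathcal X$ be a measurable space, let $\Phi \subset \mathcal L$ be a nonempty set of functions, and let $\mathcal P$ be the hypothesis generated by $\Phi$. Let $\mathcal C = \mathrm{cone}(\Phi) - \mathcal L^\Phi_p$ and let $\overline{\mathcal C}$ be the closure of $\mathcal C$ in $\mathcal L^\Phi$ with respect to the weak topology $\sigma(\mathcal L^\Phi,\mathcal M^\Phi)$. Then: (i) A function $f \in \mathcal L^\Phi$ satisfies $\int_{\mathcal X} f\, d\mu \le 0$ for all $\mu \in \mathcal P$ if and only if $f \in \overline{\mathcal C}$. (ii) In particular, the set $\mathcal E$ of all e-variables for $\mathcal P$ consists precisely of those $[0,\infty]$-valued measurable functions on $\mathcal X$ that are $\mathcal P$-q.s. equal to $1+f$ for some $f \in \overline{\mathcal C}$.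
   Context: $\mathcal L$ is the set of all real-valued measurable functions on $\mathcal X$, $\mathcal M$ the set of finite signed measures on $\mathcal X$ (with $|\mu|$ the total variation measure of $\mu$), $\mathcal M_1$ the set of probability measures on $\mathcal X$. The hypothesis generated by a nonempty set $\Phi\subset\mathcal L$ is the (possibly empty) set $$\mathcal P = \{\mu \in \mathcal M_1 : \int_{\mathcal X} |f|\, d\mu < \infty \text{ and } \int_{\mathcal X} f\, d\mu \le 0 \text{ for all } f \in \Phi\}.$$ A measurable set $A$ is $\mathcal P$-negligible if $\mu(A)=0$ for all $\mu\in\mathcal P$; a pointwise property holds $\mathcal P$-quasi-surely ($\mathcal P$-q.s.) if the set where it fails is $\mathcal P$-negligible. An e-variable for $\mathcal P$ is a measurable $h:\mathcal X\to[0,\infty]$ with $\int_{\mathcal X} h\,d\mu\le 1$ for all $\mu\in\mathcal P$. Define $\mathcal L^\Phi = \{f\in\mathcal L: \int |f|\,d\mu<\infty \text{ for all } \mu\in\mathcal P\}$, $\mathcal M^\Phi = \{\mu\in\mathcal M: \int |f|\,d|\mu|<\infty \text{ for all } f\in\mathcal L^\Phi\}$, $\mathcal L^\Phi_p = \{f\in\mathcal L^\Phi : f\ge 0,\ \mathcal P\text{-q.s.}\}$. $\mathrm{cone}(\Phi)$ is the set of all finite linear combinations of elements of $\Phi$ with nonnegative coefficients, and $A-B=\{a-b: a\in A, b\in B\}$. $\sigma(\mathcal L^\Phi,\mathcal M^\Phi)$ is the weakest topology on $\mathcal L^\Phi$ making $f\mapsto \int_{\mathcal X} f\,d\mu$ continuous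 for every $\mu\in\mathcal M^\Phi$. *)

(* Defs.v *)
From HB Require Import structures.
From mathcomp Require Import all_boot all_order all_algebra.
From mathcomp Require Import all_classical all_reals all_analysis.
From mathcomp Require Import measurable_realfun.

Set Implicit Arguments.
Unset Strict Implicit.
Unset Printing Implicit Defensive.

Import Order.TTheory GRing.Theory Num.Theory.
Import numFieldNormedType.Exports.

Local Open Scope classical_set_scope.
Local Open Scope ring_scope.

Section signed_measures.
Context d (X : measurableType d) (R : realType).
Implicit Type nu : {charge set X -> \bar R}.

Definition hahn_pos nu : set X := sval (cid (Hahn_decomposition nu)).

Definition hahn_neg nu : set X :=
  sval (cid (svalP (cid (Hahn_decomposition nu)))).

Lemma hahnP nu : hahn_decomposition nu (hahn_pos nu) (hahn_neg nu).
Proof. exact: svalP (cid (svalP (cid (Hahn_decomposition nu)))). Qed.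

(* By [Hahn_decomposition_uniq], these do not depend on the decomposition. *)
Definition cpos nu : {finite_measure set X -> \bar R} := jordan_pos (hahnP nu).

Definition cneg nu : {finite_measure set X -> \bar R} := jordan_neg (hahnP nu).

Definition total_variation nu : {measure set X -> \bar R} :=
  charge_variation (hahnP nu).

(* The integral of [f] against the signed measure [nu], meaningful when [f] is
   integrable for [total_variation nu]. *)
Definition cintegral nu (f : X -> R) : R :=
  Rintegral (cpos nu) setT f - Rintegral (cneg nu) setT f.

End signed_measures.

Section hypothesis_generated.
Context d (X : measurableType d) (R : realType).
Variable Phi : set {mfun X >-> R}.

Definition hypothesis : set (probability X R) :=
  [set mu | forall f, Phi f ->
    mu.-integrable setT (EFin \o f) /\ (\int[mu]_x (f x)%:E <= 0)%E].

Definition negligible_hyp (A : set X) : Prop :=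
  measurable A /\ forall mu, hypothesis mu -> mu A = 0%E.

Definition qs (Q : X -> Prop) : Prop := negligible_hyp [set x | ~ Q x].

Definition evariables : set (X -> \bar R) :=
  [set h : X -> \bar R | [/\ measurable_fun setT h, forall x, (0 <= h x)%E &
    forall mu, hypothesis mu -> (\int[mu]_x h x <= 1)%E]].

Definition LPhi : set {mfun X >-> R} :=
  [set f | forall mu, hypothesis mu -> mu.-integrable setT (EFin \o f)].

Definition MPhi : set (charge X R) :=
  [set nu | forall f, LPhi f ->
    (total_variation nu).-integrable setT (EFin \o f)].

Definition LPhi_pos : set {mfun X >-> R} :=
  LPhi `&` [set f | qs (fun x => 0 <= f x)].

Definition cone : set {mfun X >-> R} :=
  [set f | exists (n : nat) (c : 'I_n -> R) (g : 'I_n -> {mfun X >-> R}),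
    [/\ forall i, 0 <= c i, forall i, Phi (g i) &
      forall x, f x = \sum_(i < n) c i * g i x]].

Definition coneB : set {mfun X >-> R} := [set a - b | a in cone & b in LPhi_pos].

Definition LPhi_weak : topologicalType :=
  sup_topology (fun nu : MPhi => Topological.class
    (initial_topology (fun f : LPhi => cintegral (val nu) (val f)))).

Lemma coneB_LPhi : coneB `<=` LPhi.
Proof.
move=> _ [a [n [c [g [c0 Phig aE]]]]] [b [Lb _] <-] mu Pmu.
rewrite (_ : _ \o _ = (EFin \o a) \- (EFin \o b))%E//.
apply: integrableB => //; last exact: Lb.
rewrite (_ : _ \o _ = (fun x => \sum_(i < n) (c i)%:E * (g i x)%:E)%E).
  apply: integrable_sum => // i _; apply: integrableZl => //.
  by have [] := Pmu _ (Phig i).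
by apply/funext => x /=; rewrite aE -sumEFin.
Qed.

(* Closure inside [LPhi], seen again as a set of functions; by [coneB_LPhi],
   the preimage loses nothing. *)
Definition coneB_closure : set {mfun X >-> R} :=
  set_val @` @closure LPhi_weak (set_val @^-1` coneB).

End hypothesis_generated.

(* Main.v *)
Require Import Defs.
From HB Require Import structures.
From mathcomp Require Import all_boot all_order all_algebra.
From mathcomp Require Import all_classical all_reals all_analysis.
From mathcomp Require Import measurable_realfun.

Set Implicit Arguments.
Unset Strict Implicit.
Unset Printing Implicit Defensive.

Import Order.TTheory GRing.Theory Num.Theory.
Import numFieldNormedType.Exports.

Local Open Scope classical_set_scope.
Local Open Scope ring_scope.

(** Bipolar theorem for the pairing of LPhi with MPhi. If f in LPhi is not in
    the closure of C = cone(Phi) - LPhi_pos, then some finite family nu_1, ...,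
    nu_n in MPhi already separates f from C weakly, so projecting onto a closed
    convex cone of R^n yields a combination phi = sum_i l_i nu_i with
    phi(f) > 0 and phi <= 0 on C. As C contains the opposites of nonnegative
    functions of LPhi, phi is the integral against a finite positive measure m;
    as C contains Phi, the normalization of m belongs to the hypothesis, and it
    gives f a positive integral. An e-variable h is quasi-surely finite, so (ii)
    is (i) applied to h - 1. *)

(** * Separation of a point from a convex cone in Euclidean space *)

Section cone_separation.
Variables (R : realType) (n : nat).
Implicit Types (u v w a : 'rV[R]_n) (S : set 'rV[R]_n).

(** The norm carried by ['rV[R]_n] is the sup norm, so the Euclidean structure behind nearest points
    is set up by hand. *)
Definition rVdot u v : R := \sum_i u ord0 i * v ord0 i.

Lemma rVdotDl u v w : rVdot (u + v) w = rVdot u w + rVdot v w.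
Proof. by rewrite -big_split; apply: eq_bigr => i _; rewrite mxE mulrDl. Qed.

Lemma rVdotZl t u v : rVdot (t *: u) v = t * rVdot u v.
Proof. by rewrite mulr_sumr; apply: eq_bigr => i _; rewrite mxE mulrA. Qed.

Lemma rVdotC u v : rVdot u v = rVdot v u.
Proof. by apply: eq_bigr => i _; rewrite mulrC. Qed.

Lemma rVdotDr u v w : rVdot w (u + v) = rVdot w u + rVdot w v.
Proof. by rewrite rVdotC rVdotDl !(rVdotC w). Qed.

Lemma rVdotZr t u v : rVdot u (t *: v) = t * rVdot u v.
Proof. by rewrite rVdotC rVdotZl rVdotC. Qed.

(** The factor [t] is pulled out so that a comparison of the squared distances at [p] and at
    [p + t z] can be divided by [t]. *)
Lemma rVdotBZ t u v : rVdot (u - t *: v) (u - t *: v) =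
  rVdot u u - t * (2 * rVdot u v - t * rVdot v v).
Proof.
rewrite -scaleNr !(rVdotDl, rVdotDr, rVdotZl, rVdotZr) (rVdotC v u).
rewrite mulr_natl mulr2n mulrBr mulrDr opprB opprD !mulNr mulrN opprK.
by rewrite -!addrA; congr +%R; rewrite [RHS]addrC -addrA.
Qed.

Lemma rVdot_ge0 u : 0 <= rVdot u u.
Proof. by apply: sumr_ge0 => i _; rewrite -expr2 sqr_ge0. Qed.

Lemma sqr_coord_le_rVdot u i : u ord0 i ^+ 2 <= rVdot u u.
Proof.
rewrite /rVdot (bigD1 i)//= expr2 lerDl.
by apply: sumr_ge0 => j _; rewrite -expr2 sqr_ge0.
Qed.

Lemma rVdot_gt0 u : u != 0 -> 0 < rVdot u u.
Proof.
move=> u0; rewrite lt_neqAle rVdot_ge0 andbT eq_sym.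
apply: contra u0 => /eqP uu; apply/eqP/rowP => i; rewrite mxE.
apply/eqP; rewrite -sqrf_eq0 eq_le sqr_ge0 andbT -uu.
exact: sqr_coord_le_rVdot.
Qed.

Lemma coordB_continuous a i : continuous (fun z : 'rV[R]_n => (a - z) ord0 i).
Proof.
rewrite (_ : (fun _ => _) = (fun z : 'rV[R]_n => a ord0 i - z ord0 i)).
  move=> z; apply: (@cvgB R R^o 'rV[R]_n (nbhs z)); first exact: cvg_cst.
  exact: coord_continuous.
by apply/funext => z; rewrite !mxE.
Qed.

Lemma rVdot_continuous a :
  continuous (fun z : 'rV[R]_n => rVdot (a - z) (a - z)).
Proof.
apply: (continuous_big (@add_continuous R)) => i _ z.
by apply: (@cvgM R _ (nbhs z)); exact: coordB_continuous.
Qed.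

(** Each coordinate [c] has [|c| <= max(1, c^2)]. This bounds the sublevel sets of the squared
    distance. *)
Lemma norm_le_rVdot u : `|u| <= rVdot u u + 1.
Proof.
rewrite /Num.norm/= mx_normrE; apply: bigmax_le => [|[i j] _ /=].
  by rewrite addr_ge0// rVdot_ge0.
rewrite ord1; have := sqr_coord_le_rVdot u j; rewrite -real_normK ?num_real//.
move=> cu; have [c1|/ltW c1] := leP `|u ord0 j| 1.
  by rewrite (le_trans c1)// lerDr rVdot_ge0.
by rewrite (@le_trans _ _ (`|u ord0 j| ^+ 2)) ?ler_eXnr// (le_trans cu)// lerDl.
Qed.

(** The preimage of [closure S] under [f] is closed and contains [S]. This carries the cone
    operations over to the closure. *)
Lemma closure_invariant S (f : 'rV[R]_n -> 'rV[R]_n) : continuous f ->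
  (forall y, S y -> S (f y)) -> forall y, closure S y -> closure S (f y).
Proof.
move=> cf Sf; have cl : closed (f @^-1` closure S).
  by apply: preimage_closed; [move=> x _; exact: cf|exact: closed_closure].
suff : closure S `<=` f @^-1` closure S by move=> h y /h.
rewrite (closure_id (f @^-1` closure S)).1 -/(closure S)//.
by apply: closure_subset => y /Sf Sfy; exact: subset_closure.
Qed.

(** The minimum is attained on the compact part of the closure lying no farther from [a] than a
    fixed [s0] in [S]; the points left out do worse than [s0]. *)
Lemma closure_nearest_point S a : S !=set0 ->
  exists2 p, closure S p &
    forall z, closure S z -> rVdot (a - p) (a - p) <= rVdot (a - z) (a - z).
Proof.
move=> [s0 Ss0]; pose q (z : 'rV[R]_n) := rVdot (a - z) (a - z).
pose K := closure S `&` [set z : 'rV[R]_n | q z <= q s0].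
have Kne : K !=set0 by exists s0; split; [exact: subset_closure|exact: lexx].
have cK : compact K.
  apply: bounded_closed_compact.
    exists (`|a| + (q s0 + 1)); split; first exact: num_real.
    move=> M /ltW aM z [_ /= qz]; apply: le_trans aM.
    rewrite -[z](subKr a) (le_trans (ler_normB _ _))// lerD2l.
    by rewrite (le_trans (norm_le_rVdot _))// lerD2r.
  apply: closedI; first exact: closed_closure.
  apply: (@preimage_closed _ _ q [set r | r <= q s0]).
    by move=> z _; exact: rVdot_continuous.
  exact: closed_le.
have cq : {within K, continuous q}.
  by apply: continuous_subspaceT; exact: rVdot_continuous.
have [p /[!inE] -[clp qp] pmin] := EVT_min_rV Kne cK cq.
exists p => // z clz; have [qz|/ltW qz] := leP (q z) (q s0).
  by apply: pmin; rewrite inE.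
exact: le_trans qz.
Qed.

(** The limit [t -> 0] made explicit: a positive [x] is refuted at [t = x / (c + x)], where
    [t * c <= x < 2 * x]. *)
Lemma le0_of_le_small (x c : R) : 0 <= c ->
  (forall t, 0 < t <= 1 -> 2 * x <= t * c) -> x <= 0.
Proof.
move=> c0 h; rewrite leNgt; apply/negP => x0.
have d0 : 0 < c + x by rewrite ltr_wpDl.
have : 0 < x / (c + x) <= 1.
  by rewrite divr_gt0//= ler_pdivrMr// mul1r lerDr.
move=> /h; apply/negP; rewrite -ltNge (@le_lt_trans _ _ x)//.
  by rewrite mulrAC ler_pdivrMr// ler_pM2l// lerDl ltW.
by rewrite mulr_natl mulr2n ltrDl.
Qed.

(* The separating vector is [a - p] with [p] a point of [closure S] nearest to
   [a]: compare [p] with [p + t y] for [y] in [S], and with [(1 - t) p]. *)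
Lemma cone_separation S a : S 0 ->
  (forall y z, S y -> S z -> S (y + z)) ->
  (forall t y, 0 <= t -> S y -> S (t *: y)) ->
  ~ closure S a ->
  exists2 l, 0 < rVdot l a & forall y, S y -> rVdot l y <= 0.
Proof.
move=> S0 SD SZ aS; have [|p clp pmin] := @closure_nearest_point S a.
  by exists 0.
pose w := a - p.
have step z :
      (forall t, 0 < t <= 1 -> closure S (p + t *: z)) ->
    rVdot w z <= 0.
  move=> clz; apply: (@le0_of_le_small _ (rVdot z z)); first exact: rVdot_ge0.
  move=> t t01; have := pmin _ (clz _ t01).
  rewrite opprD addrA -/w rVdotBZ lerBrDr gerDl.
  by case/andP: t01 => t0 _; rewrite pmulr_rle0// subr_le0.
have wp : 0 <= rVdot w p.
  have : rVdot w (-1 *: p) <= 0.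
    apply: step => t /andP[_ t1]; rewrite scalerA mulrN1 scaleNr.
    rewrite -[X in X - _]scale1r -scalerBl.
    apply: (@closure_invariant S (fun y => (1 - t) *: y)) => //.
      exact: scaler_continuous.
    by move=> y; apply: SZ; rewrite subr_ge0.
  by rewrite rVdotZr mulN1r oppr_le0.
exists w.
  (* As [a = w + p], the product with [a] is [rVdot w w + rVdot w p], and [w] is nonzero because [a]
     lies outside the closure. *)
  rewrite -[a](subrK p) -/w rVdotDr ltr_wpDr// rVdot_gt0//.
  by rewrite subr_eq0; apply/eqP => ap; apply: aS; rewrite ap.
move=> y Sy; apply: step => t /andP[/ltW t0 _].
apply: (@closure_invariant S (fun z => z + t *: y)) => //.
  by move=> z; apply: (@cvgD R 'rV[R]_n _ (nbhs z));
    [exact: cvg_id|exact: cvg_cst].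
by move=> z Sz; apply: SD => //; exact: SZ.
Qed.

End cone_separation.

(** * Integration against sums and multiples of measures *)

Section measure_operations.
Context d (X : measurableType d) (R : realType).
Implicit Types (m a b : {measure set X -> \bar R}) (f : X -> \bar R).
Local Open Scope ereal_scope.

Lemma eq_measure_integrable a b f : (forall A, measurable A -> a A = b A) ->
  a.-integrable setT f -> b.-integrable setT f.
Proof.
move=> ab /integrableP[mf fa]; apply/integrableP; split => //.
by rewrite (eq_measure_integral a)// => A mA _; rewrite ab.
Qed.

Lemma integrable_measure_addP a b f : (measure_add a b).-integrable setT f <->
  a.-integrable setT f /\ b.-integrable setT f.
Proof.
split=> [/integrableP[mf]|[/integrableP[mf fa] /integrableP[_ fb]]].
  have mnf : measurable_fun setT (abse \o f) by exact: measurableT_comp.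
  rewrite ge0_integral_measure_add// => fab.
  split; apply/integrableP; split=> //; apply: le_lt_trans fab.
    by rewrite leeDl// integral_ge0.
  by rewrite leeDr// integral_ge0.
apply/integrableP; split => //; rewrite ge0_integral_measure_add//.
  exact: lte_add_pinfty.
exact: measurableT_comp.
Qed.

Lemma integrable_mscale (k : {nonneg R}) m f : m.-integrable setT f ->
  (mscale k m).-integrable setT f.
Proof.
move=> /integrableP[mf fm]; apply/integrableP; split => //.
rewrite ge0_integral_mscale//; last exact: measurableT_comp.
by rewrite lte_mul_pinfty// lee_fin.
Qed.

(** The nonnegative case is applied to both parts of [f]; the negative part has a finite integral,
    so the product distributes over the difference. *)
Lemma integral_mscale (k : {nonneg R}) m f : m.-integrable setT f ->
  \int[mscale k m]_x f x = k%:num%:E * \int[m]_x f x.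
Proof.
move=> fm; have mf := measurable_int _ fm.
have mp := measurable_funepos mf; have mn := measurable_funeneg mf.
transitivity (k%:num%:E * \int[m]_x f^\+ x - k%:num%:E * \int[m]_x f^\- x).
  by rewrite [LHS]integralE; congr (_ - _); exact: ge0_integral_mscale.
rewrite -muleBr//; first by congr (_ * _); rewrite [RHS]integralE.
by apply: fin_num_adde_defl; rewrite fin_numN; exact: integrable_neg_fin_num.
Qed.

Local Open Scope ring_scope.

Lemma Rintegral_measure_add a b (g : X -> R) :
  a.-integrable setT (EFin \o g) -> b.-integrable setT (EFin \o g) ->
  Rintegral (measure_add a b) setT g = Rintegral a setT g + Rintegral b setT g.
Proof.
move=> ga gb; rewrite /Rintegral integral_measure_add// fineD//.
  exact: (integrable_fin_num measurableT ga).
exact: (integrable_fin_num measurableT gb).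
Qed.

Lemma Rintegral_mscale (k : {nonneg R}) m (g : X -> R) :
  m.-integrable setT (EFin \o g) ->
  Rintegral (mscale k m) setT g = k%:num * Rintegral m setT g.
Proof.
move=> gm; rewrite /Rintegral integral_mscale// fineM//.
exact: (integrable_fin_num measurableT gm).
Qed.

Lemma eq_measure_Rintegral a b (g : X -> R) :
  (forall A, measurable A -> a A = b A) ->
  Rintegral a setT g = Rintegral b setT g.
Proof.
by move=> ab; rewrite /Rintegral (eq_measure_integral b)// => A mA _; exact: ab.
Qed.

(** On a subset of [hahn_neg nu] the charge is both nonpositive and nonnegative, so the negative
    part vanishes and the Jordan decomposition reduces to the positive part. *)
Lemma cpos_ge0 (nu : {charge set X -> \bar R}) :
  (forall A, measurable A -> 0 <= nu A)%E ->
  forall A, measurable A -> cpos nu A = nu A /\ cneg nu A = 0%E.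
Proof.
move=> nu0 A mA; have [_ [mN negN] _ _] := hahnP nu.
have mAN : measurable (A `&` hahn_neg nu) by exact: measurableI.
have negA : cneg nu A = 0%E.
  rewrite [LHS](cjordan_negE (hahnP nu)) /crestr0 mem_set// /crestr.
  apply/eqP; rewrite oppe_eq0 eq_le nu0// andbT.
  by apply: negN => //; exact: subIsetr.
split=> //; rewrite (jordan_decomp (hahnP nu) mA).
by rewrite -[RHS]/(cpos nu A + (-1)%:E * cneg nu A)%E negA mule0 adde0.
Qed.

End measure_operations.

(** * Linear functionals given by a difference of two measures *)

Section measure_difference.
Context d (X : measurableType d) (R : realType).
Variable L : set {mfun X >-> R}.
Implicit Types (m a b : {measure set X -> \bar R}) (phi : {mfun X >-> R} -> R).

(* Phrasing this with two positive measures, rather than with a charge, avoids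
   relating Hahn decompositions of different charges. *)
Definition measure_difference phi : Prop :=
  exists a b, forall g, L g ->
    [/\ a.-integrable setT (EFin \o g), b.-integrable setT (EFin \o g) &
        phi g = Rintegral a setT g - Rintegral b setT g].

Lemma measure_difference0 : measure_difference (fun=> 0).
Proof.
exists mzero, mzero => g _; have int0 : mzero.-integrable setT (EFin \o g).
  apply/integrableP; split; first exact/measurable_EFinP.
  by rewrite integral_measure_zero.
by split=> //; rewrite subrr.
Qed.

Lemma measure_differenceD phi psi : measure_difference phi ->
  measure_difference psi -> measure_difference (fun g => phi g + psi g).
Proof.
move=> [a [b ab]] [a' [b' ab']]; exists (measure_add a a'), (measure_add b b').
move=> g Lg; have [ga gb ->] := ab g Lg; have [ga' gb' ->] := ab' g Lg.
split; [exact/integrable_measure_addP|exact/integrable_measure_addP|].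
by rewrite !Rintegral_measure_add// opprD addrACA.
Qed.

Lemma measure_differenceZ k phi : measure_difference phi ->
  measure_difference (fun g => k * phi g).
Proof.
move=> [a [b ab]]; have [k0|/ltW k0] := leP 0 k.
  exists (mscale (NngNum k0) a), (mscale (NngNum k0) b) => g /ab[ga gb ->].
  split; [exact: integrable_mscale|exact: integrable_mscale|].
  by rewrite !Rintegral_mscale//= mulrBr.
(* For negative [k], the two measures exchange roles and are scaled by [- k]. *)
have nk0 : 0 <= - k by rewrite oppr_ge0.
exists (mscale (NngNum nk0) b), (mscale (NngNum nk0) a) => g /ab[ga gb ->].
split; [exact: integrable_mscale|exact: integrable_mscale|].
by rewrite !Rintegral_mscale//= !mulNr opprK mulrBr [RHS]addrC.
Qed.

Lemma measure_difference_sum (I : Type) (r : seq I)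
    (phi : I -> {mfun X >-> R} -> R) : (forall i, measure_difference (phi i)) ->
  measure_difference (fun g => \sum_(i <- r) phi i g).
Proof.
move=> dphi; elim: r => [|i r IH].
  by under eq_fun do rewrite big_nil; exact: measure_difference0.
by under eq_fun do rewrite big_cons; exact: measure_differenceD.
Qed.

(** Indicators force [a] and [b] to be finite and give [phi] the value [a A - b A] on the indicator
    of [A]. So [a - b] is a nonnegative charge, and [m] is its positive part. *)
Lemma measure_difference_ge0 phi :
  (forall A (mA : measurable A), L (indic_mfun A mA)) ->
  (forall A (mA : measurable A), 0 <= phi (indic_mfun A mA)) ->
  measure_difference phi ->
  exists m : {finite_measure set X -> \bar R}, forall g, L g ->
    m.-integrable setT (EFin \o g) /\ phi g = Rintegral m setT g.
Proof.
move=> Lindic phi0 [a [b ab]].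
have fin (c : {measure set X -> \bar R}) :
    (forall g, L g -> c.-integrable setT (EFin \o g)) ->
    (c setT < +oo)%E.
  move=> /(_ _ (Lindic _ measurableT)) /integrableP[_].
  rewrite (eq_integral (cst 1%E)) ?integral_cst ?mul1e// => x _ /=.
  by rewrite /mindic indicT normr1.
have aoo : (a setT < +oo)%E by apply: fin => g /ab[].
have boo : (b setT < +oo)%E by apply: fin => g /ab[].
have RintE (c : {measure set X -> \bar R}) A (mA : measurable A) :
    (c setT < +oo)%E ->
    (Rintegral c setT (indic_mfun A mA))%:E = c A.
  move=> coo; rewrite /Rintegral integral_indic// setIT fineK//.
  by rewrite ge0_fin_numE// (le_lt_trans _ coo)// le_measure// inE.
(* Restriction to the whole space changes no value; it provides the finite measure structure from
   which charges are built. *)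
pose fa := mfrestr measurableT aoo; pose fb := mfrestr measurableT boo.
have faE A : fa A = a A by rewrite /fa /mfrestr /mrestr setIT.
have fbE A : fb A = b A by rewrite /fb /mfrestr /mrestr setIT.
pose nu : {charge set X -> \bar R} :=
  cadd (charge_of_finite_measure fa) (copp (charge_of_finite_measure fb)).
have nuE A : nu A = (a A - b A)%E.
  by rewrite -faE -fbE.
have nu0 A : measurable A -> (0 <= nu A)%E.
  move=> mA; rewrite nuE -(RintE a A mA)// -(RintE b A mA)// -EFinB lee_fin.
  by have [_ _ <-] := ab _ (Lindic A mA).
(* In the form [m + b = a], the identity involves positive measures only, and integrability for [m]
   follows from integrability for [a]. *)
have cE A : measurable A -> measure_add (cpos nu) b A = a A.
  move=> mA; transitivity (cpos nu A + b A)%E; first exact: measure_addE.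
  rewrite (cpos_ge0 nu0 mA).1 nuE subeK//.
  by rewrite -(RintE b A mA).
exists (cpos nu) => g Lg; have [ga gb ->] := ab g Lg.
have /integrable_measure_addP[gm _] :
    (measure_add (cpos nu) b).-integrable setT (EFin \o g).
  by apply: eq_measure_integrable ga => A mA; exact/esym/cE.
split=> //; rewrite -(eq_measure_Rintegral g cE) Rintegral_measure_add//.
by rewrite addrK.
Qed.

End measure_difference.

(** * The hypothesis, its integrable functions and the cone they contain *)

Section generated_hypothesis.
Context d (X : measurableType d) (R : realType).
Variable Phi : set {mfun X >-> R}.
Implicit Types (f g : {mfun X >-> R}) (nu : charge X R) (mu : probability X R).

Lemma LPhi_gen f : Phi f -> LPhi Phi f.
Proof. by move=> Pf mu /(_ _ Pf)[]. Qed.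

Lemma LPhiD f g : LPhi Phi f -> LPhi Phi g -> LPhi Phi (f + g).
Proof.
move=> Lf Lg mu Pmu; rewrite (_ : _ \o _ = (EFin \o f) \+ (EFin \o g))%E//.
by apply: integrableD => //; [exact: Lf|exact: Lg].
Qed.

Lemma LPhiZ k f : LPhi Phi f -> LPhi Phi (scale_mfun k f).
Proof.
move=> Lf mu Pmu; rewrite (_ : _ \o _ = (fun x => k%:E * (EFin \o f) x))%E.
  by apply: integrableZl => //; exact: Lf.
by apply/funext => x /=; rewrite mulrC EFinM.
Qed.

Lemma LPhi_indic A (mA : measurable A) : LPhi Phi (indic_mfun A mA).
Proof. by move=> mu _; exact: integrable_indic. Qed.

(** The exceptional set of [S] is covered by those of [P] and [Q]; its measurability is a premise
    because [negligible_hyp] includes it. *)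
Lemma qs_impl2 (P Q S : X -> Prop) : measurable [set x | ~ S x] ->
  (forall x, P x -> Q x -> S x) -> qs Phi P -> qs Phi Q -> qs Phi S.
Proof.
move=> mS PQS [mP P0] [mQ Q0]; split=> // mu Pmu.
apply/eqP; rewrite eq_le measure_ge0 andbT.
have -> : 0%E = (mu [set x | ~ P x] + mu [set x | ~ Q x])%E :> \bar R.
  by rewrite P0// Q0// adde0.
rewrite (le_trans _ (measureU2 _ mP mQ))// le_measure ?inE//.
  exact: measurableU.
move=> x /= nS; apply: contrapT => /not_orP[/contrapT Px /contrapT].
by move=> /(PQS _ Px).
Qed.

Lemma measurable_not_ge0 f : measurable [set x | ~ (0 <= f x)].
Proof.
rewrite (_ : [set x | _] = setT `&` f @^-1` `]-oo, 0[).
  exact: measurable_funPT.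
apply/seteqP; split=> x /=; rewrite in_itv/=.
  by move=> /negP; rewrite -ltNge.
by rewrite ltNge => -[_ /negP].
Qed.

Lemma LPhi_posD f g : LPhi_pos Phi f -> LPhi_pos Phi g -> LPhi_pos Phi (f + g).
Proof.
move=> [Lf f0] [Lg g0]; split; first exact: LPhiD.
by apply: qs_impl2 f0 g0; [exact: measurable_not_ge0|move=> x; exact: addr_ge0].
Qed.

Lemma LPhi_posZ k f : 0 <= k -> LPhi_pos Phi f -> LPhi_pos Phi (scale_mfun k f).
Proof.
move=> k0 [Lf f0]; split; first exact: LPhiZ.
apply: (@qs_impl2 (fun x => 0 <= f x) (fun x => 0 <= f x)) => //.
  exact: measurable_not_ge0.
by move=> x fx _ /=; rewrite mulr_ge0.
Qed.

Lemma ge0_LPhi_pos f : LPhi Phi f -> (forall x, 0 <= f x) -> LPhi_pos Phi f.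
Proof.
move=> Lf f0; split=> //; rewrite /= /qs /negligible_hyp.
rewrite (_ : [set x | _] = set0); first by split=> // mu _; rewrite measure0.
by apply/seteqP; split=> x //=; rewrite f0.
Qed.

Lemma cone0 : cone Phi 0.
Proof.
exists 0%N, (fun=> 0), (fun=> 0); split=> [[]//|[]//|x].
by rewrite big_ord0.
Qed.

Lemma cone_gen f : Phi f -> cone Phi f.
Proof.
by move=> Pf; exists 1%N, (fun=> 1), (fun=> f); split=> // x;
  rewrite big_ord1 mul1r.
Qed.

Lemma coneD f g : cone Phi f -> cone Phi g -> cone Phi (f + g).
Proof.
move=> [n [c [u [c0 Pu fE]]]] [m [c' [u' [c'0 Pu' gE]]]].
pose join T (v : 'I_n -> T) (v' : 'I_m -> T) (i : 'I_(n + m)) :=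
  match fintype.split i with inl j => v j | inr j => v' j end.
exists (n + m)%N, (join R c c'), (join _ u u'); split=> [i|i|x].
- by rewrite /join; case: fintype.split.
- by rewrite /join; case: fintype.split.
- rewrite -[LHS]/(f x + g x) fE gE big_split_ord /=.
  congr (_ + _); apply: eq_bigr => i _.
    by rewrite /join (unsplitK (inl i)).
  by rewrite /join (unsplitK (inr i)).
Qed.

Lemma coneZ k f : 0 <= k -> cone Phi f -> cone Phi (scale_mfun k f).
Proof.
move=> k0 [n [c [u [c0 Pu fE]]]]; exists n, (fun i => k * c i), u; split=> //.
  by move=> i; rewrite mulr_ge0.
move=> x /=; rewrite fE mulr_suml; apply: eq_bigr => i _.
by rewrite mulrC mulrA.
Qed.

Lemma coneB_gen f : Phi f -> coneB Phi f.
Proof.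
move=> Pf; exists f; first exact: cone_gen.
exists 0; last by rewrite subr0.
by apply: ge0_LPhi_pos => // mu _; exact: integrable0.
Qed.

Lemma coneB_oppr_ge0 f : LPhi Phi f -> (forall x, 0 <= f x) -> coneB Phi (- f).
Proof.
move=> Lf f0; exists 0; first exact: cone0.
by exists f; [exact: ge0_LPhi_pos|rewrite sub0r].
Qed.

Lemma coneBD f g : coneB Phi f -> coneB Phi g -> coneB Phi (f + g).
Proof.
move=> [a Ca [b Lb <-]] [a' Ca' [b' Lb' <-]].
exists (a + a'); first exact: coneD.
by exists (b + b'); [exact: LPhi_posD|rewrite opprD addrACA].
Qed.

Lemma coneBZ k f : 0 <= k -> coneB Phi f -> coneB Phi (scale_mfun k f).
Proof.
move=> k0 [a Ca [b Lb <-]]; exists (scale_mfun k a); first exact: coneZ.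
exists (scale_mfun k b); first exact: LPhi_posZ.
by apply/mfuneqP => x /=; rewrite mulrBl.
Qed.

(** * Pairing of [LPhi] with [MPhi] *)

Lemma MPhi_integrable nu f : MPhi Phi nu -> LPhi Phi f ->
  (cpos nu).-integrable setT (EFin \o f) /\
  (cneg nu).-integrable setT (EFin \o f).
Proof.
move=> Mnu /Mnu nuf; apply/integrable_measure_addP.
by apply: eq_measure_integrable nuf => A mA; exact/esym/measure_addE.
Qed.

Lemma measure_difference_cintegral nu : MPhi Phi nu ->
  measure_difference (LPhi Phi) (fun f => cintegral nu f).
Proof.
move=> Mnu; exists (cpos nu), (cneg nu) => f Lf.
by have [fp fn] := MPhi_integrable Mnu Lf; split.
Qed.

Lemma cintegralD nu f g : MPhi Phi nu -> LPhi Phi f -> LPhi Phi g ->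
  cintegral nu (f + g) = cintegral nu f + cintegral nu g.
Proof.
move=> Mnu Lf Lg; have [fp fn] := MPhi_integrable Mnu Lf.
have [gp gn] := MPhi_integrable Mnu Lg.
by rewrite /cintegral !RintegralD// opprD addrACA.
Qed.

Lemma cintegralZ nu k f : MPhi Phi nu -> LPhi Phi f ->
  cintegral nu (scale_mfun k f) = k * cintegral nu f.
Proof.
move=> Mnu Lf; have [fp fn] := MPhi_integrable Mnu Lf.
by rewrite /cintegral !RintegralZr// -mulrBl mulrC.
Qed.

Lemma cintegralN nu f : MPhi Phi nu -> LPhi Phi f ->
  cintegral nu (- f) = - cintegral nu f.
Proof.
move=> Mnu Lf; rewrite -[RHS]mulN1r -cintegralZ//; congr cintegral.
by apply/funext => x /=; rewrite mulrN1.
Qed.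

(** A probability has zero negative part, so its total variation and [cintegral] are the original
    measure and integral. Thus each [mu] of the hypothesis acts as a weakly continuous
    functional. *)
Lemma MPhi_hypothesis mu : hypothesis Phi mu ->
  MPhi Phi (charge_of_finite_measure mu) /\
  forall f, cintegral (charge_of_finite_measure mu) f = Rintegral mu setT f.
Proof.
move=> Pmu; set nu : charge X R := charge_of_finite_measure mu.
have nu0 A : measurable A -> (0 <= nu A)%E by move=> _; exact: measure_ge0.
have cE := cpos_ge0 nu0; split.
  move=> f /(_ _ Pmu); apply: eq_measure_integrable => A mA.
  transitivity (cpos nu A + cneg nu A)%E => //.
  by rewrite (cE _ mA).1 (cE _ mA).2 adde0.
move=> f; rewrite /cintegral.
rewrite (@eq_measure_Rintegral _ _ _ (cpos nu) mu) => [|A mA]; last first.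
  by rewrite [LHS](cE _ mA).1.
rewrite (@eq_measure_Rintegral _ _ _ (cneg nu) mzero) => [|A mA]; last first.
  by rewrite [LHS](cE _ mA).2.
by rewrite [X in _ - X]/Rintegral integral_measure_zero subr0.
Qed.

(** * The weak topology and its finite-dimensional projections *)

Lemma cintegral_continuous (nu : MPhi Phi) :
  continuous (fun f : LPhi_weak Phi => cintegral (val nu) (val f) : R).
Proof.
move=> f; pose Tc (nu : MPhi Phi) := Topological.class
  (initial_topology (fun f : LPhi Phi => cintegral (val nu) (val f))).
(* The neighbourhood filter of [f] converges to [f] in the supremum topology, hence in the initial
   topology of each [nu]. *)
have fnu := (@cvg_sup _ _ Tc (nbhs (f : LPhi_weak Phi)) f _).1 (fun A => id) nu.
move=> A /(@initial_continuous _ R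
  (fun f : LPhi Phi => cintegral (val nu) (val f)) f).
exact: fnu.
Qed.

Definition cintegrals (s : seq (MPhi Phi)) f : 'rV[R]_(size s) :=
  \row_i cintegral (val (tnth (in_tuple s) i)) f.

(** A weak neighbourhood of [f] can be shrunk to a bound on finitely many integrals, so it meets
    [coneB] as soon as the corresponding projection of [coneB] comes close enough to that of [f]. *)
Lemma coneB_closure_cintegrals f : LPhi Phi f ->
  (forall s, closure (cintegrals s @` coneB Phi) (cintegrals s f)) ->
  coneB_closure Phi f.
Proof.
move=> Lf clf; pose f' : LPhi Phi := exist _ f (mem_set Lf).
exists f' => //= B Bf.
pose close s (e : R) (g : LPhi Phi) := all (fun nu : MPhi Phi =>
  `|cintegral (val nu) f - cintegral (val nu) (val g)| < e) s.
(* The filter generated by the basic sets [close s e], to be compared with the weak neighbourhoods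
   of [f]. *)
pose F : set_system (LPhi Phi) :=
  [set B | exists s (e : R), 0 < e /\ close s e `<=` B].
have FF : Filter F.
  split.
  - by exists [::], 1.
  - move=> A C [s [e [e0 sA]]] [s' [e' [e'0 sC]]].
    exists (s ++ s'), (Order.min e e'); split; first by rewrite lt_min e0.
    move=> g; rewrite /close all_cat => /andP[sg s'g]; split.
      apply: sA; apply: sub_all sg => nu /lt_le_trans; apply.
      by rewrite ge_min lexx.
    apply: sC; apply: sub_all s'g => nu /lt_le_trans; apply.
    by rewrite ge_min lexx orbT.
  - by move=> A C AC [s [e [e0 sA]]]; exists s, e; split=> // g /sA/AC.
pose Tc (nu : MPhi Phi) := Topological.class
  (initial_topology (fun f : LPhi Phi => cintegral (val nu) (val f))).
(* Convergence in a supremum topology is tested in each initial topology, so a single charge is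
   handled at a time. *)
have Ff : nbhs (f' : LPhi_weak Phi) `<=` F.
  apply: (@cvg_sup _ _ Tc F f' FF).2 => nu A [_ [[V oV <-] Vf] VA].
  have /nbhs_ballP[e /= e0 eV] : nbhs (cintegral (val nu) f) V.
    by apply: open_nbhs_nbhs; split.
  exists [:: nu], e; split=> // g; rewrite /close/= andbT => ge.
  by apply: VA; exact: eV.
have [s [e [e0 sB]]] := Ff _ Bf.
have [_ [[g Cg <-] [_ fg]]] := clf s _ (nbhsx_ballx (cintegrals s f) e e0).
exists (exist _ g (mem_set (coneB_LPhi Cg))); split => //=.
apply: sB; rewrite /close; apply/(@all_tnthP _ _ _ (in_tuple s)) => i /=.
by have := fg ord0 i; rewrite !mxE.
Qed.

(** * Sign of the integrals under the hypothesis *)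

Lemma Rintegral_cone_le0 mu f : hypothesis Phi mu -> cone Phi f ->
  Rintegral mu setT f <= 0.
Proof.
move=> Pmu [n [c [u [c0 Pu /funext ->]]]].
(* Induction on the list of indices carries integrability along with the sign, since additivity of
   [Rintegral] relies on it. *)
suff h (r : seq 'I_n) : let v x := \sum_(i <- r) c i * u i x in
    mu.-integrable setT (EFin \o v) /\ Rintegral mu setT v <= 0.
  by have [] := h (index_enum 'I_n).
elim: r => [|i r [IHi IH]] /=.
  under eq_fun do rewrite big_nil.
  split; first exact: integrable0.
  by rewrite /Rintegral integral0.
under eq_fun do rewrite big_cons.
have [ui ui0] := Pmu _ (Pu i).
have cui : mu.-integrable setT (EFin \o (fun x => c i * u i x)).
  rewrite (_ : _ \o _ = (fun x => (c i)%:E * (EFin \o u i) x)%E).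
    exact: integrableZl.
  by apply/funext => x /=; rewrite EFinM.
split.
  rewrite (_ : _ \o _ = ((EFin \o (fun x => (c i * u i x)%R)) \+
    (EFin \o (fun x => (\sum_(j <- r) c j * u j x)%R)))%E)//.
  exact: integrableD.
rewrite RintegralD// RintegralZl// -[leRHS]addr0 lerD// mulr_ge0_le0//.
by rewrite -lee_fin fineK// integrable_fin_num.
Qed.

Lemma Rintegral_LPhi_pos_ge0 mu f : hypothesis Phi mu -> LPhi_pos Phi f ->
  0 <= Rintegral mu setT f.
Proof.
move=> Pmu [Lf [mN N0]]; rewrite /Rintegral.
(* The null set where [f] is negative is removed from the domain. *)
rewrite (negligible_integral mN)//; [|exact: Lf|exact: N0].
by apply/fine_ge0/integral_ge0 => x [_ /= /contrapT]; by rewrite lee_fin.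
Qed.

Lemma Rintegral_coneB_le0 mu f : hypothesis Phi mu -> coneB Phi f ->
  Rintegral mu setT f <= 0.
Proof.
move=> Pmu [a Ca [b Lb <-]].
(* Written as [a - 0], the function [a] lies in [coneB], hence in [LPhi]. *)
have La : LPhi Phi a.
  apply: coneB_LPhi; exists a => //; exists 0; last by rewrite subr0.
  by apply: ge0_LPhi_pos => // m _; exact: integrable0.
rewrite RintegralB//; [|exact: La|by case: Lb => Lb _; exact: Lb].
rewrite subr_le0 (le_trans (Rintegral_cone_le0 Pmu Ca))//.
exact: Rintegral_LPhi_pos_ge0.
Qed.

(** * Normalization of a finite measure into a member of the hypothesis *)

Lemma mnormalizeE (m : {finite_measure set X -> \bar R}) mu A :
  m setT != 0%E -> mnormalize m mu A = ((fine (m setT))^-1%:E * m A)%E.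
Proof.
move=> m0; have moo : m setT != +oo%E.
  by rewrite -ltey ltey_eq fin_num_measure.
by rewrite /mnormalize (negbTE m0) (negbTE moo) muleC.
Qed.

Lemma normalize_hypothesis (m : {finite_measure set X -> \bar R}) :
  m setT != 0%E ->
  (forall f, Phi f ->
    m.-integrable setT (EFin \o f) /\ Rintegral m setT f <= 0) ->
  exists2 mu : probability X R, hypothesis Phi mu &
    forall f, m.-integrable setT (EFin \o f) ->
      Rintegral mu setT f = (fine (m setT))^-1 * Rintegral m setT f.
Proof.
(* Nonzero mass yields a point [x], whose Dirac measure is the default value that [mnormalize] takes
   as an argument. *)
move=> m0 Pm; have [x _] : [set: X] !=set0.
  by apply/set0P; apply: contra m0 => /eqP ->; rewrite measure0.
have k0 : 0 <= (fine (m setT))^-1 by rewrite invr_ge0 fine_ge0.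
pose k := NngNum k0; pose mu : probability X R := mnormalize m \d_x.
have muE A : measurable A -> mscale k m A = mu A.
  by move=> mA; rewrite -[RHS]/(mnormalize m \d_x A) mnormalizeE.
have Rmu f : m.-integrable setT (EFin \o f) ->
    Rintegral mu setT f = (fine (m setT))^-1 * Rintegral m setT f.
  by move=> fm; rewrite -(eq_measure_Rintegral f muE) Rintegral_mscale.
exists mu => // f Pf; have [fm f0] := Pm _ Pf.
have fmu : mu.-integrable setT (EFin \o f).
  by apply: eq_measure_integrable muE _; exact: integrable_mscale.
split=> //; rewrite -[leLHS]fineK; last exact: integrable_fin_num.
by rewrite lee_fin -/(Rintegral mu setT f) Rmu// mulr_ge0_le0.
Qed.

Lemma coneB_closureP f : LPhi Phi f ->
  ((forall mu, hypothesis Phi mu -> (\int[mu]_x (f x)%:E <= 0)%E) <->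
   coneB_closure Phi f).
Proof.
move=> Lf; split=> [f0|[f' clf' f'E] mu Pmu].
  apply: coneB_closure_cintegrals => // s; apply: contrapT.
  have Ms i : MPhi Phi (val (tnth (in_tuple s) i)).
    exact: set_mem (valP (tnth (in_tuple s) i)).
  move=> nclf; have C0 : (cintegrals s @` coneB Phi) 0.
    (* Zero is written as an opposite so that [coneB_oppr_ge0] applies. *)
    exists (- 0); first by apply: coneB_oppr_ge0 => // mu _; exact: integrable0.
    apply/rowP => i; rewrite !mxE /cintegral /Rintegral oppr0 !integral0.
    by rewrite subrr.
  have CD y z : (cintegrals s @` coneB Phi) y ->
      (cintegrals s @` coneB Phi) z ->
      (cintegrals s @` coneB Phi) (y + z).
    move=> [g Cg <-] [h Ch <-]; exists (g + h); first exact: coneBD.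
    by apply/rowP => i; rewrite !mxE cintegralD//; exact: coneB_LPhi.
  have CZ t y : 0 <= t -> (cintegrals s @` coneB Phi) y ->
      (cintegrals s @` coneB Phi) (t *: y).
    move=> t0 [g Cg <-]; exists (scale_mfun t g); first exact: coneBZ.
    by apply/rowP => i; rewrite !mxE cintegralZ//; exact: coneB_LPhi.
  have [l lf lC] := cone_separation C0 CD CZ nclf.
  pose phi g := rVdot l (cintegrals s g).
  have phiC g : coneB Phi g -> phi g <= 0 by move=> Cg; apply: lC; exists g.
  (* On indicators [phi] is nonnegative because their opposites lie in [coneB]. As a linear
     combination of measure differences, [phi] is one itself, so a finite measure [m] represents
     it. *)
  have [||m mphi] := @measure_difference_ge0 _ _ _ (LPhi Phi) phi LPhi_indic.
  - move=> A mA; have Li := LPhi_indic mA; rewrite -oppr_le0.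
    have Cn : coneB Phi (- indic_mfun A mA) by apply: coneB_oppr_ge0 => // x.
    rewrite (le_trans _ (phiC _ Cn))// /phi /rVdot -sumrN ler_sum// => i _.
    by rewrite !mxE cintegralN// mulrN.
  - apply: measure_difference_sum => i; under eq_fun do rewrite mxE.
    by apply: measure_differenceZ; exact: measure_difference_cintegral.
  have [fm phifE] := mphi f Lf.
  have mf : 0 < Rintegral m setT f by rewrite -phifE.
  (* The null measure would give [f] a zero integral, so [m] can be normalized. *)
  have [m0|m0] := eqVneq (m setT) 0%E.
    move: mf; rewrite /Rintegral null_set_integral ?ltxx//.
    exact: (measurable_int _ fm).
  have [f1|mu Pmu muE] := normalize_hypothesis m0.
    move=> Pf1; have [m1 <-] := mphi _ (LPhi_gen Pf1); split=> //.
    exact/phiC/coneB_gen.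
  (* The integral of [f] against [mu] is a positive multiple of the one against [m], which
     contradicts [f0]. *)
  have := f0 mu Pmu; rewrite -[leLHS]fineK; last first.
    exact: integrable_fin_num (Lf _ Pmu).
  rewrite lee_fin -/(Rintegral mu setT f) muE// pmulr_rle0 ?leNgt ?mf//.
  rewrite invr_gt0 fine_gt0// lt_neqAle eq_sym m0 measure_ge0.
  by rewrite ltey_eq fin_num_measure.
(* Conversely, the half-space where integration against [mu] is nonpositive is weakly closed and
   contains [coneB], hence also its closure. *)
have [Mmu muE] := MPhi_hypothesis Pmu.
pose nu : MPhi Phi :=
  exist (fun nu : charge X R => nu \in MPhi Phi) _ (mem_set Mmu).
rewrite -[leLHS]fineK; last exact: integrable_fin_num (Lf _ Pmu).
rewrite lee_fin -/(Rintegral mu setT f) -muE -f'E.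
have cl : closed ((fun g : LPhi_weak Phi => cintegral (val nu) (val g) : R)
    @^-1` [set r | r <= 0]).
  apply: preimage_closed; last exact: closed_le.
  by move=> g _; exact: cintegral_continuous.
apply: cl; apply: closure_subset clf' => g Cg /=.
by rewrite muE; exact: Rintegral_coneB_le0.
Qed.

(** Quasi-sure equality is almost everywhere equality for each [mu] of the hypothesis, and the
    constant 1 integrates to 1. This exchanges bounds on [h] for bounds on [f]. *)
Lemma integral_qs_eq mu f (h : X -> \bar R) : hypothesis Phi mu -> LPhi Phi f ->
  measurable_fun setT h -> qs Phi (fun x => h x = (1 + f x)%:E) ->
  (\int[mu]_x h x = 1 + \int[mu]_x (f x)%:E)%E.
Proof.
move=> Pmu Lf mh [mN N0].
transitivity (\int[mu]_x (cst 1 x + (EFin \o f) x))%E.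
  apply: ae_eq_integral => //.
    apply: emeasurable_funD; first exact: measurable_cst.
    exact/measurable_EFinP.
  exists [set x | ~ h x = (1 + f x)%:E]; split=> //; first exact: N0.
  by move=> x /=; apply: contra_not => + _.
rewrite integralD//; [|exact: finite_measure_integrable_cst|exact: Lf].
by rewrite integral_cst// mul1e; congr (_ + _)%E; exact: probability_setT.
Qed.

End generated_hypothesis.

Theorem theorem2p2 (R : realType) (d : measure_display) (X : measurableType d)
    (Phi : set {mfun X >-> R}) (Phi0 : Phi !=set0) :
  (forall f : {mfun X >-> R}, LPhi Phi f ->
    ((forall mu : probability X R, hypothesis Phi mu ->
        (\int[mu]_x (f x)%:E <= 0)%E) <->
     coneB_closure Phi f)) /\
  evariables Phi =
    [set h : X -> \bar R | [/\ measurable_fun setT h, forall x, (0 <= h x)%E &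
      exists2 f : {mfun X >-> R}, coneB_closure Phi f &
        qs Phi (fun x => h x = (1 + f x)%:E)]].
Proof.
split; first by move=> f; exact: coneB_closureP.
apply/seteqP; split=> h [mh h0].
  move=> h1; split=> //.
  have hint mu : hypothesis Phi mu -> mu.-integrable setT h.
    move=> /h1 hmu; apply/integrableP; split=> //.
    under eq_integral do rewrite gee0_abs//.
    by rewrite (le_lt_trans hmu)// ltry.
  have mf : measurable_fun setT (fun x => fine (h x) - 1).
    apply: measurable_funB => //.
    by apply: measurableT_comp => //; exact: measurable_fine.
  (* As [fine] sends [+oo] to 0, this is [h - 1] where [h] is finite and -1 elsewhere. *)
  pose f : {mfun X >-> R} := HB.pack (fun x => fine (h x) - 1)
    (isMeasurableFun.Build _ _ _ _ _ mf).
  have hfE : [set x | ~ h x = (1 + f x)%:E] = h @^-1` [set +oo%E].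
    apply/seteqP; split=> x /=; last by move=> ->.
    by case: (h x) (h0 x) => //= r _; rewrite addrC subrK.
  have qf : qs Phi (fun x => h x = (1 + f x)%:E).
    rewrite /qs hfE; split=> [|mu Pmu].
      by rewrite -[X in measurable X]setTI; exact: mh.
    (* Being integrable, [h] is finite almost everywhere for each [mu]. *)
    have [N [mN N0 subN]] := integrable_ae measurableT (hint mu Pmu).
    apply/eqP; rewrite eq_le measure_ge0 andbT -N0 le_measure ?inE//.
      by rewrite -[X in measurable X]setTI; exact: mh.
    by move=> x /= hx; apply: subN => /= /(_ I); rewrite hx.
  have Lf : LPhi Phi f.
    move=> mu /hint hmu.
    (* Domination by [h + 1], which is integrable since [mu] is finite. *)
    apply: (@le_integrable _ _ _ _ _ _ _ (h \+ cst 1)%E) => //.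
    - exact/measurable_EFinP.
    - move=> x _ /=; case: (h x) (h0 x) => [r r0|_|]//=; last by rewrite leey.
      rewrite lee_fin [leRHS]ger0_norm ?addr_ge0//.
      by rewrite (le_trans (ler_normB _ _))// normr1 ger0_norm.
    - by apply: integrableD => //; exact: finite_measure_integrable_cst.
  exists f => //; apply/coneB_closureP => // mu Pmu.
  have := h1 mu Pmu; rewrite (integral_qs_eq Pmu Lf mh qf).
  by rewrite -[leRHS]adde0 leeD2lE.
move=> [f clf [mN N0]]; split=> // mu Pmu.
(* Elements of [coneB_closure] are images of points of the subtype [LPhi], which carry this
   membership. *)
have Lf : LPhi Phi f by case: clf => -[f' Lf'] _ <-; exact: set_mem.
rewrite (integral_qs_eq Pmu Lf mh (conj mN N0)) -[leRHS]adde0 leeD2lE//.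
exact: (coneB_closureP Lf).2.
Qed.
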